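(* Let $G=(V,E)$ be a graph and let $\mathbf B^T(G)=(\lambda_G,S_G)$ be a burning of $G$ with end time $T$. Then the function $\lambda_G$ defines a unique graph map $G\to P_T$ which coincides with $\lambda_G$ on the set of vertices $V$ of $G$.
   Context: A graph $G=(V_G,E_G)$ is a non-empty finite set $V_G$ of vertices together with a set $E_G$ of unordered pairs of distinct vertices. A graph map $f\colon G\to H$ is a map $f\colon V_G\to V_H$ such that for every edge $\{v,w\}\in E_G$ either $\{f(v),f(w)\}\in E_H$ or $f(v)=f(w)$. The path graph $P_n$ has vertices $\{1,\dots,n\}$ and edges $\{i,i+1\}$, $i=1,\dots,n-1$. The distance $d_G(v,w)$ is the length of a shortest path from $v$ to $w$ ($\infty$ if there is none). Let $S_G=(v_1,\dots,v_k)$, $k\ge 1$, be a non-empty ordered set of vertices of $G$. For $2\le j\le k+1$ let $U_j$ be the induced subgraph of $G$ on the vertices $w$ such that $d_G(v_i,w)\le j-i$ for some $1\le i\le j-1$. For $1\le j\le k+1$ let $\mathcal N_j$ be the induced subgraph of $G$ on the vertices $w$ such that $d_G(v_i,w)\le j-i$ for some $1\le i\le \min(j,k)$. The sequence $S_G$ is a burning sequence if $v_j\notin U_j$ for $2\le j\le k$ and $U_{k+1}=G$. In this case $\lambda_G(v)=\min\{i\mid v\in\mathcal N_i\}$ for $v\in V_G$; the pair $\mathbf B(G)=(\lambda_G,S_G)$ is called a burning of $G$, and $T=\max\{\lambda_G(v)\mid v\in V_G\}$ is its end time; one writes $\mathbf B^T(G)$ to indicate the end time. *)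

(* Defs.v *)
From mathcomp Require Import all_boot.

Set Implicit Arguments.
Unset Strict Implicit.
Unset Printing Implicit Defensive.

Record graph : Type := Graph {
  vertex :> finType;
  edges : {set {set vertex}};
  edges_pair : forall e, e \in edges -> #|e| = 2;
  vertex_gt0 : 0 < #|vertex|
}.

Definition graph_map (G H : graph) (f : G -> H) : Prop :=
  forall v w : G, [set v; w] \in edges G ->
    [set f v; f w] \in edges H \/ f v = f w.

Section PathGraph.
Variables (n : nat) (n_gt0 : 0 < n).

(* [iota 1 n] is [:: 1; ...; n]; [n_gt0] makes the vertex set non-empty. *)
Definition path_edges : {set {set seq_sub (iota 1 n)}} :=
  [set e | [exists i : seq_sub (iota 1 n), exists j : seq_sub (iota 1 n),
             (ssval j == (ssval i).+1) && (e == [set i; j])]].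

Lemma path_edges_pair e : e \in path_edges -> #|e| = 2.
Proof.
rewrite inE => /existsP[i /existsP[j /andP[/eqP ij /eqP->]]].
rewrite cards2; case: eqP => // eij.
by move: ij; rewrite eij => /n_Sn.
Qed.

Lemma path_vertex_gt0 : 0 < #|{: seq_sub (iota 1 n)}|.
Proof.
have h : 1 \in iota 1 n by rewrite mem_iota /= add1n ltnS.
by apply/card_gt0P; exists (SeqSub h).
Qed.

Definition path_graph : graph := Graph path_edges_pair path_vertex_gt0.

Definition path_label (i : path_graph) : nat := ssval (i : seq_sub (iota 1 n)).

End PathGraph.

Section Distance.
Variable G : graph.

Definition adj : rel G := fun v w => [set v; w] \in edges G.

Definition has_path_of_length (v w : G) (n : nat) : bool :=
  [exists p : n.-tuple G, [&& path adj v p, uniq (v :: p) & last v p == w]].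

Lemma connect_has_path v w :
  connect adj v w -> exists n, has_path_of_length v w n.
Proof.
case/connectP=> p + ->; case/shortenP=> q qP qU _.
exists (size q); apply/existsP; exists (in_tuple q).
by apply/and3P; split.
Qed.

(* [None] stands for an infinite distance. *)
Definition dist (v w : G) : option nat :=
  match boolP (connect adj v w) with
  | AltTrue vw => Some (ex_minn (connect_has_path vw))
  | AltFalse _ => None
  end.

Definition dist_le (v w : G) (n : nat) : bool :=
  if dist v w is Some d then d <= n else false.

End Distance.

(* [tnth S i] is the vertex v_(i+1) of (v_1, ..., v_k), while the argument j of
   [burnU] and [burnN] is 1-based. An induced subgraph of G is determined by,
   and represented by, its vertex set. *)
Section Burning.
Variables (G : graph) (k : nat) (S : k.-tuple G).

Definition burnU (j : nat) : {set G} :=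
  [set w | [exists i : 'I_k, (i.+1 <= j - 1) && dist_le (tnth S i) w (j - i.+1)]].

Definition burnN (j : nat) : {set G} :=
  [set w | [exists i : 'I_k,
              (i.+1 <= minn j k) && dist_le (tnth S i) w (j - i.+1)]].

Definition burning_sequence : Prop :=
  [/\ 0 < k,
      uniq S,
      forall j : 'I_k, 2 <= j.+1 -> tnth S j \notin burnU j.+1
    & burnU k.+1 = [set: G]].

Lemma burnN_exists (v : G) :
  burning_sequence -> exists i, (1 <= i <= k.+1) && (v \in burnN i).
Proof.
case=> _ _ _ eU; exists k.+1; rewrite leqnn /=.
have : v \in burnU k.+1 by rewrite eU inE.
rewrite !inE => /existsP[i /andP[_ di]]; apply/existsP; exists i.
by rewrite di leq_min !ltn_ord ltnW // ltnS ltn_ord.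
Qed.

End Burning.

Record burning (G : graph) : Type := Burning {
  burn_length : nat;
  burn_seq : burn_length.-tuple G;
  burn_seqP : burning_sequence burn_seq
}.

Section BurningFunction.
Variables (G : graph) (B : burning G).

Definition lambda (v : G) : nat := ex_minn (burnN_exists v (burn_seqP B)).

Definition end_time : nat := \max_(v : G) lambda v.

Lemma end_time_gt0 : 0 < end_time.
Proof.
have /card_gt0P[v _] := vertex_gt0 G.
apply: leq_trans (leq_bigmax v); rewrite /lambda.
by case: ex_minnP => i /andP[/andP[]].
Qed.

End BurningFunction.

(* Main.v *)
Require Import Defs.
From mathcomp Require Import all_boot.

(** The fire spreads by one edge per time step: a vertex at distance at most
    [j - i] from the source [v_i] has its neighbours at distance at most
    [j.+1 - i] from the same source.  So the burning times of adjacent vertices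
    differ by at most one ([lambda_adj]), and the vertices of a path graph
    with labels differing by at most one are equal or joined by an edge
    ([path_graph_near]).  Burning times lie between 1 and the end time [T], hence
    they are labels of vertices of [P_T]; as a label determines its vertex
    ([path_label_inj]), the map to [P_T] exists and is unique. *)

Set Implicit Arguments.
Unset Strict Implicit.
Unset Printing Implicit Defensive.

Section Distance.
Variable G : graph.
Implicit Types u v w : G.

Lemma adj_sym : symmetric (@adj G).
Proof. by move=> v w; rewrite /adj setUC. Qed.

(** Distances are minimal lengths of paths without repeated vertices, but
    removing loops only shortens a path, so arbitrary walks bound them too. *)
Lemma dist_leP u w n :
  reflect (exists p, [/\ path (@adj G) u p, last u p = w & size p <= n])
          (dist_le u w n).
Proof.
rewrite /dist_le /dist; case: {-}_ / boolP => [uw | nuw].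
  case: ex_minnP => d dP dmin; apply: (iffP idP) => [dn | [p [pP pl pn]]].
    by case/existsP: dP => q /and3P[qP _ /eqP ql]; exists q; rewrite size_tuple.
  move: pl; case/shortenP: pP => r rP rU rsub rl.
  apply: leq_trans pn; apply: leq_trans (uniq_leq_size _ rsub).
    by apply/dmin/existsP; exists (in_tuple r); rewrite /= rP rl eqxx andbT.
  by case/andP: rU.
apply: ReflectF => -[p [pP pl _]].
by case/negP: nuw; apply/connectP; exists p.
Qed.

Lemma dist_le_adj u v w n : adj v w -> dist_le u v n -> dist_le u w n.+1.
Proof.
move=> vw /dist_leP[p [pP pl pn]]; apply/dist_leP; exists (rcons p w).
by rewrite rcons_path pP pl vw last_rcons size_rcons.
Qed.

End Distance.

Lemma burnN_adj (G : graph) k (S : k.-tuple G) j (v w : G) :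
  adj v w -> v \in burnN S j -> w \in burnN S j.+1.
Proof.
move=> vw; rewrite !inE => /existsP[i /andP[ij dv]]; apply/existsP; exists i.
move: ij; rewrite !leq_min => /andP[ij ->]; rewrite leqW //= subSn //.
exact: dist_le_adj dv.
Qed.

Section BurningTimes.
Variables (G : graph) (B : burning G).
Implicit Types v w : G.

Lemma lambda_bounds v : 1 <= lambda B v <= end_time B.
Proof.
rewrite leq_bigmax andbT /lambda.
by case: ex_minnP => i /andP[/andP[]].
Qed.

Lemma lambda_adj v w : adj v w -> lambda B w <= (lambda B v).+1.
Proof.
move=> vw; rewrite {2}/lambda; case: ex_minnP => i /andP[/andP[_ _] vi] _.
rewrite /lambda; case: ex_minnP => j /andP[/andP[_ jk] _] jmin.
(* Times range up to k + 1 only, and by then every vertex has burned. *)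
have [ik | ki] := leqP i.+1 (burn_length B).+1; last exact: leq_trans jk (ltnW ki).
by apply: jmin; rewrite ik; apply: burnN_adj vi.
Qed.

End BurningTimes.

Section PathGraph.
Variables (n : nat) (n_gt0 : 0 < n).

Lemma path_label_inj : injective (@path_label n n_gt0).
Proof. exact: val_inj. Qed.

Lemma path_label_surj m : 1 <= m <= n -> exists x, @path_label n n_gt0 x = m.
Proof.
move=> mn; have hm : m \in iota 1 n by rewrite mem_iota add1n ltnS.
by exists (SeqSub hm).
Qed.

Lemma path_edgeS (x y : path_graph n_gt0) :
  path_label y = (path_label x).+1 -> [set x; y] \in edges (path_graph n_gt0).
Proof.
move=> xy; rewrite inE; apply/existsP; exists x; apply/existsP; exists y.
by rewrite eqxx andbT; apply/eqP.
Qed.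

Lemma path_graph_near (x y : path_graph n_gt0) :
  path_label x <= (path_label y).+1 -> path_label y <= (path_label x).+1 ->
  [set x; y] \in edges (path_graph n_gt0) \/ x = y.
Proof.
move=> xy yx; case: (ltngtP (path_label x) (path_label y)) => [lt | gt | eq].
- by left; apply: path_edgeS; apply/eqP; rewrite eqn_leq yx.
- by left; rewrite setUC; apply: path_edgeS; apply/eqP; rewrite eqn_leq xy.
- by right; apply: path_label_inj.
Qed.

End PathGraph.

Theorem theorem3p5 (G : graph) (B : burning G) :
  exists! f : {ffun G -> path_graph (end_time_gt0 B)},
    graph_map f /\ (forall v : G, path_label (f v) = lambda B v).
Proof.
have fP v : exists x : path_graph (end_time_gt0 B), path_label x == lambda B v.
  have [x xv] := path_label_surj (end_time_gt0 B) (lambda_bounds B v).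
  by exists x; apply/eqP.
pose f := [ffun v => xchoose (fP v)].
have fE v : path_label (f v) = lambda B v.
  by rewrite ffunE; apply/eqP/(xchooseP (fP v)).
exists f; split=> [|g [_ gE]]; last first.
  by apply/ffunP=> v; apply: path_label_inj; rewrite fE gE.
split=> // v w vw; apply: path_graph_near; rewrite !fE; apply: lambda_adj => //.
by rewrite adj_sym.
Qed.
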